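(* The knowledge operator $K$ is implicitly defined in the logic $\Sigma_{HK}$; that is, if $K'$ is a new unary operator and $\Sigma_{HK}[K/K']$ is the logic obtained from $\Sigma_{HK}$ by replacing $K$ by $K'$ everywhere, then $Kp\leftrightarrow K'p\in\Sigma_{HK}+\Sigma_{HK}[K/K']$, where $p$ is a propositional letter.
   Context: For a family of unary operators $(O_i)$, $\mathcal{L}((O_i))$ is the set of formulas built from countably many propositional letters by $\neg$, $\wedge$ and the operators $O_i$. A logic in such a language is a set of formulas containing all propositional tautologies and closed under modus ponens, uniform substitution, and replacement of provable equivalents (from $\phi\leftrightarrow\psi$ infer $O\phi\leftrightarrow O\psi$ for each operator $O$ of the language). $\Lambda+\Lambda'$ is the smallest logic, in the language containing all operators involved, that contains $\Lambda\cup\Lambda'$. $\Sigma_{HK}$ is the logic in the language with operators $L_r$ ($r\in\mathbb{Q}\cap[0,1]$) and $K$ that is the smallest logic containing: the probability axioms (A1) $L_0\phi$; (A2) $L_r\top$; (A3) $L_r(\phi\wedge\psi)\wedge L_t(\phi\wedge\neg\psi)\to L_{r+t}\phi$ for $r+t\le 1$; (A4) $\neg L_r(\phi\wedge\psi)\wedge\neg L_s(\phi\wedge\neg\psi)\to\neg L_{r+s}\phi$ for $r+s\le1$; (A5) $L_r\phi\to\neg L_s\neg\phi$ for $r+s>1$; $(4_p)$ $L_r\phi\to L_1L_r\phi$; $(5_p)$ $\neg L_r\phi\to L_1\neg L_r\phi$; the $S_5$ axioms $K(\phi\to\psi)\to(K\phi\to K\psi)$, $K\phi\to\phi$, $K\phi\to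 KK\phi$, $\neg K\phi\to K\neg K\phi$; the connecting axioms $(H1)$ $L_r\phi\to KL_r\phi$, $(H2)$ $\neg L_r\phi\to K\neg L_r\phi$, $(H3)$ $K\phi\to L_1\phi$; and closed under (DIS): from $\phi\leftrightarrow\psi$ infer $L_r\phi\leftrightarrow L_r\psi$; (ARCH): if $\gamma\to L_s\phi$ is a theorem for all $s<r$, then $\gamma\to L_r\phi$ is a theorem; and generalization for $K$: from $\phi$ infer $K\phi$. *)

(* Defs.v *)
From mathcomp Require Import all_boot all_order all_algebra.

Set Implicit Arguments.
Unset Strict Implicit.
Unset Printing Implicit Defensive.

Import Order.TTheory GRing.Theory Num.Theory.
Local Open Scope ring_scope.

(* A family of unary operators is given by its index type O; [form O] is then
   the language generated by that family. *)
Inductive form (O : Type) : Type :=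
| Var of nat
| Neg of form O
| And of form O & form O
| Op of O & form O.

Arguments Var {O} _.

Definition Imp (O : Type) (phi psi : form O) : form O := Neg (And phi (Neg psi)).
Definition Iff (O : Type) (phi psi : form O) : form O :=
  And (Imp phi psi) (Imp psi phi).
Definition Top (O : Type) : form O := Neg (And (Var 0) (Neg (Var 0))).
Arguments Top {O}.

Fixpoint subst (O : Type) (sigma : nat -> form O) (phi : form O) : form O :=
  match phi with
  | Var n => sigma n
  | Neg a => Neg (subst sigma a)
  | And a b => And (subst sigma a) (subst sigma b)
  | Op o a => Op o (subst sigma a)
  end.

Fixpoint map_op (O O' : Type) (f : O -> O') (phi : form O) : form O' :=
  match phi with
  | Var n => Var n
  | Neg a => Neg (map_op f a)
  | And a b => And (map_op f a) (map_op f b)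
  | Op o a => Op (f o) (map_op f a)
  end.

(* Truth-functional evaluation: letters and formulas [Op o a] are the atoms. *)
Fixpoint eval (O : Type) (v : nat -> bool) (w : O -> form O -> bool)
    (phi : form O) : bool :=
  match phi with
  | Var n => v n
  | Neg a => ~~ eval v w a
  | And a b => eval v w a && eval v w b
  | Op o a => w o a
  end.

Definition tautology (O : Type) (phi : form O) : Prop :=
  forall (v : nat -> bool) (w : O -> form O -> bool), eval v w phi = true.

Record is_logic (O : Type) (Lam : form O -> Prop) : Prop := IsLogic {
  logic_taut : forall phi, tautology phi -> Lam phi;
  logic_mp : forall phi psi, Lam (Imp phi psi) -> Lam phi -> Lam psi;
  logic_subst : forall sigma phi, Lam phi -> Lam (subst sigma phi);
  logic_repl : forall o phi psi,
    Lam (Iff phi psi) -> Lam (Iff (Op o phi) (Op o psi))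
}.

(* The image of a set of formulas under a translation of the operators. *)
Definition translate (O O' : Type) (f : O -> O') (Lam : form O -> Prop)
    (phi : form O') : Prop :=
  exists2 psi, Lam psi & phi = map_op f psi.

(* The sum of two logics, both already regarded as sets of formulas of the
   joint language [form O]: the smallest logic containing them.  It is closed
   under the rules in [is_logic] only, not under any further rule under which
   the summands happen to be closed. *)
Definition logic_sum (O : Type) (Lam Lam' : form O -> Prop) (phi : form O) : Prop :=
  forall Gam : form O -> Prop, is_logic Gam ->
    (forall psi, Lam psi -> Gam psi) ->
    (forall psi, Lam' psi -> Gam psi) ->
    Gam phi.

Definition prob : Type := {r : rat | 0 <= r <= 1}.

Lemma prob0_subproof : (0 : rat) <= (0 : rat) <= 1.
Proof. by []. Qed.
Lemma prob1_subproof : (0 : rat) <= (1 : rat) <= 1.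
Proof. by []. Qed.
Definition prob0 : prob := exist _ 0 prob0_subproof.
Definition prob1 : prob := exist _ 1 prob1_subproof.

Lemma prob_add_subproof (r t : prob) :
  val r + val t <= 1 -> 0 <= val r + val t <= 1.
Proof.
by move=> ->; rewrite andbT addr_ge0 //; [case/andP: (valP r)|case/andP: (valP t)].
Qed.
Definition prob_add (r t : prob) (h : val r + val t <= 1) : prob :=
  exist _ (val r + val t) (prob_add_subproof h).

Inductive opHK : Type := opL of prob | opK.

Notation L r phi := (Op (opL r) phi).
Notation K phi := (Op opK phi).

Inductive HK_axiom : form opHK -> Prop :=
| A1 phi : HK_axiom (L prob0 phi)
| A2 r : HK_axiom (L r Top)
| A3 r t (h : val r + val t <= 1) phi psi :
    HK_axiom (Imp (And (L r (And phi psi)) (L t (And phi (Neg psi))))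
                  (L (prob_add h) phi))
| A4 r s (h : val r + val s <= 1) phi psi :
    HK_axiom (Imp (And (Neg (L r (And phi psi))) (Neg (L s (And phi (Neg psi)))))
                  (Neg (L (prob_add h) phi)))
| A5 r s (h : 1 < val r + val s) phi :
    HK_axiom (Imp (L r phi) (Neg (L s (Neg phi))))
| Four_p r phi : HK_axiom (Imp (L r phi) (L prob1 (L r phi)))
| Five_p r phi : HK_axiom (Imp (Neg (L r phi)) (L prob1 (Neg (L r phi))))
| K_dist phi psi : HK_axiom (Imp (K (Imp phi psi)) (Imp (K phi) (K psi)))
| K_truth phi : HK_axiom (Imp (K phi) phi)
| K_pos phi : HK_axiom (Imp (K phi) (K (K phi)))
| K_neg phi : HK_axiom (Imp (Neg (K phi)) (K (Neg (K phi))))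
| H1 r phi : HK_axiom (Imp (L r phi) (K (L r phi)))
| H2 r phi : HK_axiom (Imp (Neg (L r phi)) (K (Neg (L r phi))))
| H3 phi : HK_axiom (Imp (K phi) (L prob1 phi)).

Record HK_closed (Lam : form opHK -> Prop) : Prop := HKClosed {
  HK_ax : forall phi, HK_axiom phi -> Lam phi;
  HK_DIS : forall r phi psi, Lam (Iff phi psi) -> Lam (Iff (L r phi) (L r psi));
  HK_ARCH : forall r gamma phi,
    (forall s : prob, val s < val r -> Lam (Imp gamma (L s phi))) ->
    Lam (Imp gamma (L r phi));
  HK_gen : forall phi, Lam phi -> Lam (K phi)
}.

Definition Sigma_HK (phi : form opHK) : Prop :=
  forall Lam : form opHK -> Prop, is_logic Lam -> HK_closed Lam -> Lam phi.

(* The operators [L_r], [K] together with the new operator [K']. *)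
Inductive opHKK' : Type := jointL of prob | jointK | jointK'.

Definition keepK (o : opHK) : opHKK' :=
  match o with opL r => jointL r | opK => jointK end.

Definition replaceK (o : opHK) : opHKK' :=
  match o with opL r => jointL r | opK => jointK' end.

(* Main.v *)
From mathcomp Require Import all_boot all_order all_algebra.
Require Import Defs.

Set Implicit Arguments.
Unset Strict Implicit.
Unset Printing Implicit Defensive.

Import Order.TTheory GRing.Theory Num.Theory.
Local Open Scope ring_scope.

(** Both knowledge operators are pinned down by the probability operator that
    they share.  Knowing [phi] is the same as being certain of knowing it:
    [L_1 (K phi) <-> K phi] is a theorem of [Sigma_HK].  From left to right this
    is where negative introspection enters: if [K phi] fails then it is known,
    hence certain, to fail, and then (A5) forbids certainty of [K phi].  So
    [K phi] is equivalent to a formula whose head is [L_1], and (H1) for the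
    other operator, at the instance [L_1 (K phi) -> K' (L_1 (K phi))], yields
    [K phi -> K' (K phi)].  Since [K phi -> phi], monotonicity of [K'] gives
    [K phi -> K' phi]; the converse follows by exchanging the two operators.

    The sum of the two logics is not given with generalization for [K'], so
    monotonicity of [K'] with respect to implications provable in the sum
    must be recovered from replacement of equivalents ([logic_op_monotone]). *)

Section Logic.

Variables (O : Type) (Lam : form O -> Prop).
Hypothesis LamP : is_logic Lam.
Implicit Types a b c : form O.

Lemma logic_imp_trans a b c : Lam (Imp a b) -> Lam (Imp b c) -> Lam (Imp a c).
Proof.
move=> ab bc; apply: (logic_mp LamP) bc; apply: (logic_mp LamP) ab.
apply: (logic_taut LamP) => v w /=.
by case: (eval v w a); case: (eval v w b); case: (eval v w c).
Qed.

Lemma logic_iff_intro a b : Lam (Imp a b) -> Lam (Imp b a) -> Lam (Iff a b).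
Proof.
move=> ab ba; apply: (logic_mp LamP) ba; apply: (logic_mp LamP) ab.
apply: (logic_taut LamP) => v w /=.
by case: (eval v w a); case: (eval v w b).
Qed.

Lemma logic_iff_fwd a b : Lam (Iff a b) -> Lam (Imp a b).
Proof.
apply: (logic_mp LamP); apply: (logic_taut LamP) => v w /=.
by case: (eval v w a); case: (eval v w b).
Qed.

Lemma logic_iff_bwd a b : Lam (Iff a b) -> Lam (Imp b a).
Proof.
apply: (logic_mp LamP); apply: (logic_taut LamP) => v w /=.
by case: (eval v w a); case: (eval v w b).
Qed.

Lemma logic_imp_cut_neg a b c :
  Lam (Imp a (Neg b)) -> Lam (Imp (Neg c) b) -> Lam (Imp a c).
Proof.
move=> anb ncb; apply: (logic_mp LamP) ncb; apply: (logic_mp LamP) anb.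
apply: (logic_taut LamP) => v w /=.
by case: (eval v w a); case: (eval v w b); case: (eval v w c).
Qed.

(** A provable [a -> b] makes [a] equivalent to [a /\ b]; replacement turns this
    into [o a <-> o (a /\ b)]. *)
Lemma logic_op_monotone (o : O) a b :
  (forall c d, Lam (Imp (Op o (And c d)) (Op o d))) ->
  Lam (Imp a b) -> Lam (Imp (Op o a) (Op o b)).
Proof.
move=> opI ab; apply: logic_imp_trans (opI a b).
apply/logic_iff_fwd/(logic_repl LamP)/logic_iff_intro.
- apply: (logic_mp LamP) ab; apply: (logic_taut LamP) => v w /=.
  by case: (eval v w a); case: (eval v w b).
- apply: (logic_taut LamP) => v w /=.
  by case: (eval v w a); case: (eval v w b).
Qed.

End Logic.

Lemma Sigma_HK_logic : is_logic Sigma_HK.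
Proof.
split.
- by move=> phi taut Lam LamP _; apply: (logic_taut LamP).
- move=> phi psi imp Sphi Lam LamP LamHK.
  by apply: (logic_mp LamP (imp _ LamP LamHK)); apply: Sphi.
- by move=> s phi Sphi Lam LamP LamHK; apply: (logic_subst LamP); apply: Sphi.
- by move=> o phi psi Siff Lam LamP LamHK; apply: (logic_repl LamP); apply: Siff.
Qed.

Lemma Sigma_HK_axiom phi : HK_axiom phi -> Sigma_HK phi.
Proof. by move=> ax Lam _ LamHK; apply: (HK_ax LamHK). Qed.

Lemma Sigma_HK_gen phi : Sigma_HK phi -> Sigma_HK (K phi).
Proof.
by move=> Sphi Lam LamP LamHK; apply: (HK_gen LamHK); apply: Sphi.
Qed.

Lemma Sigma_HK_K_and phi psi : Sigma_HK (Imp (K (And phi psi)) (K psi)).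
Proof.
refine (logic_mp Sigma_HK_logic (Sigma_HK_axiom (K_dist _ _)) _).
refine (Sigma_HK_gen (logic_taut Sigma_HK_logic _)) => v w /=.
by case: (eval v w phi); case: (eval v w psi).
Qed.

(** Knowledge and its failure are both known, hence both certain. *)
Lemma Sigma_HK_certain_K phi : Sigma_HK (Iff (L prob1 (K phi)) (K phi)).
Proof.
have ax := Sigma_HK_axiom; have trans := logic_imp_trans Sigma_HK_logic.
refine (logic_iff_intro Sigma_HK_logic _ _); last first.
  exact: (trans _ _ _ (ax _ (K_pos _)) (ax _ (H3 _))).
have two_gt1 : (1 : rat) < val prob1 + val prob1 by [].
refine (logic_imp_cut_neg Sigma_HK_logic (ax _ (A5 two_gt1 _)) _).
exact: (trans _ _ _ (ax _ (K_neg _)) (ax _ (H3 _))).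
Qed.

Lemma translate_instance (O O' : Type) (f : O -> O') Lam Gam
    (sigma : nat -> form O') (phi : form O) :
  is_logic Gam -> (forall psi, translate f Lam psi -> Gam psi) ->
  Lam phi -> Gam (subst sigma (map_op f phi)).
Proof.
by move=> GamP sub Lphi; apply: (logic_subst GamP); apply: sub; exists phi.
Qed.

(** Stated for two arbitrary readings [f] and [g] of the operators, so that
    exchanging them gives the converse implication; they only have to agree on
    the certainty operator [L_1]. *)
Lemma knowledge_transfer (O : Type) (f g : opHK -> O) (Gam : form O -> Prop)
    (phi : form O) :
  f (opL prob1) = g (opL prob1) -> is_logic Gam ->
  (forall psi, translate f Sigma_HK psi -> Gam psi) ->
  (forall psi, translate g Sigma_HK psi -> Gam psi) ->
  Gam (Imp (Op (f opK) phi) (Op (g opK) phi)).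
Proof.
move=> fgL GamP subf subg.
have inst_f sigma psi := @translate_instance _ _ f _ _ sigma psi GamP subf.
have inst_g sigma psi := @translate_instance _ _ g _ _ sigma psi GamP subg.
have mono a b : Gam (Imp a b) -> Gam (Imp (Op (g opK) a) (Op (g opK) b)).
  apply: (logic_op_monotone GamP) => c d.
  exact: (inst_g (fun n => if n is 0 then c else d)
                 _ (Sigma_HK_K_and (Var 0) (Var 1))).
have truth : Gam (Imp (Op (f opK) phi) phi).
  exact: (inst_f (fun=> phi) _ (Sigma_HK_axiom (K_truth (Var 0)))).
have certain :
    Gam (Iff (Op (g (opL prob1)) (Op (f opK) phi)) (Op (f opK) phi)).
  by rewrite -fgL; apply: (inst_f (fun=> phi) _ (Sigma_HK_certain_K (Var 0))).
have known : Gam (Imp (Op (g (opL prob1)) (Op (f opK) phi))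
                      (Op (g opK) (Op (g (opL prob1)) (Op (f opK) phi)))).
  exact: (inst_g (fun=> Op (f opK) phi) _ (Sigma_HK_axiom (H1 prob1 (Var 0)))).
apply: (logic_imp_trans GamP (logic_iff_bwd GamP certain)).
apply: (logic_imp_trans GamP known); apply: mono.
exact: (logic_imp_trans GamP (logic_iff_fwd GamP certain) truth).
Qed.

Theorem theorem4p9 (p : nat) :
  logic_sum (translate keepK Sigma_HK) (translate replaceK Sigma_HK)
    (Iff (Op jointK (Var p)) (Op jointK' (Var p))).
Proof.
move=> Gam GamP sub sub'; apply: (logic_iff_intro GamP).
- exact: (@knowledge_transfer _ keepK replaceK).
- exact: (@knowledge_transfer _ replaceK keepK).
Qed.
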